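(* Let $N$ be the natural colouring, $N^k(n)=k(n-k+1)$, and let $N_q$ be the $q$-colouring, $N_q^k(n)=[k]_q[n-k+1]_q$ with $q=\exp(h)$ and $[k]_q=\frac{q^k-q^{-k}}{q-q^{-1}}$. Then, as $U_h(\mathfrak a)$-algebras: - $U(\mathfrak{sl}_2)[[h]]$ is isomorphic to $U_h(N)$; - $U_h(\mathfrak{sl}_2)$ is isomorphic to $U_h(N_q)$.
   Context: $\mathbb k$ is a field of characteristic zero, and $\mathbb k[[h]]$ is the ring of formal power series over $\mathbb k$. For a $\mathbb k$-vector space $V_0$, $V_0[[h]]$ denotes the module of formal series $\sum_{m\ge0}v_mh^m$ with $v_m\in V_0$. $\mathfrak a$ is the Lie algebra over $\mathbb k$ generated by $H,X^-,X^+$ subject to $[H,X^\pm]=\pm2X^\pm$. We set $U_h(\mathfrak a):=U(\mathfrak a)[[h]]$. A $U_h(\mathfrak a)$-algebra is an algebra with a structural homomorphism from $U_h(\mathfrak a)$, and homomorphisms of $U_h(\mathfrak a)$-algebras must commute with the structural maps. $U(\mathfrak{sl}_2)[[h]]$ is a $U_h(\mathfrak a)$-algebra via the canonical projection. The quantum algebra $U_h(\mathfrak{sl}_2)$ is the quotient of $U_h(\mathfrak a)$ by the smallest $h$-adically closed two-sided ideal containing $$[X^+,X^-]-\frac{q^H-q^{-H}}{q-q^{-1}},\qquad q=\exp(h),\ q^H=\exp(hH).$$ A colouring is a sequence $\psi=(\psi^k)_{k\ge1}$ of functions $\psi^k:\mathbb Z\to\mathbb k[[h]]$ satisfying: - (C1)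 $\psi^k(n)\equiv k(n-k+1)\bmod h$; - (C2) $\psi^{n+1}(n)=0$ for all $n\ge0$; - (C3) $\psi^{n+k+1}(n)=\psi^k(-n-2)$ for all $k\ge1$ and all $n\ge0$. $V_h(n,\psi)$ is the representation of $U_h(\mathfrak a)$ on $(\bigoplus_{k\ge0}\mathbb k b_k)[[h]]$ with the following action: - $H.b_k=(n-2k)b_k$; - $X^-.b_k=b_{k+1}$; - $X^+.b_0=0$, and $X^+.b_k=\psi^k(n)b_{k-1}$ for $k\ge1$. $U_h(\psi)$ is the quotient of $U_h(\mathfrak a)$ by the two-sided ideal of elements that act by zero on $V_h(n,\psi)$ for all $n\in\mathbb Z$. It is a $U_h(\mathfrak a)$-algebra via the projection. *)

(* Defs.v *)
From HB Require Import structures.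
From mathcomp Require Import all_boot all_order all_algebra.
Set Implicit Arguments. Unset Strict Implicit. Unset Printing Implicit Defensive.
Import Order.TTheory GRing.Theory Num.Theory.
Local Open Scope ring_scope.

(* Conventions.  K is the ground field k (char 0, assumed in the theorem).   *)
(* Generators of the free algebra F = k<H, X^-, X^+> are indexed by 'I_3:    *)
(*   gH = 0, gXm = 1 (X^-), gXp = 2 (X^+).                                   *)
(* A word [:: g1; ...; gr] stands for the monomial g1 * ... * gr.            *)
(* An element of F is a finite formal linear combination of words, given as *)
(* a list of (word, coefficient) terms; two lists denote the same element   *)
(* iff they have the same coefficient function [coefF].                     *)
(* An element of F[[h]] is a sequence (indexed by the power of h) of        *)
(* elements of F.  U_h(a), U(sl2)[[h]], U_h(sl2), U_h(psi) are all quotients *)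
(* of F[[h]]; each is described by the kernel of the canonical projection   *)
(* from F[[h]] (a predicate on F[[h]]).                                     *)

Section Defs.
Variable K : fieldType.

Definition word := seq 'I_3.
Definition gH  : 'I_3 := @Ordinal 3 0 isT.
Definition gXm : 'I_3 := @Ordinal 3 1 isT.
Definition gXp : 'I_3 := @Ordinal 3 2 isT.

Definition serK := nat -> K.
Definition mulK (a b : serK) : serK := fun m => \sum_(i < m.+1) a i * b (m - i)%N.
(* coefficients d_0 .. d_m of the inverse of c (c 0 <> 0) *)
Fixpoint invl (c : serK) (m : nat) : seq K :=
  match m with
  | 0 => [:: (c 0%N)^-1]
  | m'.+1 => let d := invl c m' in
      rcons d (- (c 0%N)^-1 * \sum_(i < m'.+1) c i.+1 * nth 0 d (m' - i)%N)
  end.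
Definition invK (c : serK) : serK := fun m => nth 0 (invl c m) m.

(* (q^j - q^{-j}) / h  with q = exp h, for j an integer:
   coefficient of h^m is (j^(m+1) - (-j)^(m+1)) / (m+1)! *)
Definition qdiffh (j : int) : serK :=
  fun m => ((j%:~R : K) ^+ m.+1 - (- (j%:~R : K)) ^+ m.+1) / (m.+1)`!%:R.
(* [j]_q = (q^j - q^{-j}) / (q - q^{-1}), computed as
   ((q^j - q^{-j})/h) * ((q - q^{-1})/h)^{-1} *)
Definition qint (j : int) : serK := mulK (qdiffh j) (invK (qdiffh 1)).

(* A colouring-type function psi : k -> n -> psi^k(n) in k[[h]] *)
Definition colourfun := nat -> int -> serK.

Definition natColouring : colourfun :=
  fun k n m => if m is 0%N then ((k%:Z * (n - k%:Z + 1))%:~R : K) else 0.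
Definition qColouring : colourfun :=
  fun k n => mulK (qint k%:Z) (qint (n - k%:Z + 1)).

Definition elF := seq (word * K).
Definition coefF (f : elF) (w : word) : K := \sum_(t <- f | t.1 == w) t.2.
Definition eqvF (f g : elF) := forall w, coefF f w = coefF g w.
Definition zeroF : elF := [::].
Definition addF (f g : elF) : elF := f ++ g.
Definition oppF (f : elF) : elF := [seq (t.1, - t.2) | t <- f].
Definition mulF (f g : elF) : elF := [seq (t.1 ++ u.1, t.2 * u.2) | t <- f, u <- g].

Definition idealF (P : elF -> Prop) :=
  [/\ forall f g, eqvF f g -> P f -> P g,
      P zeroF,
      forall f g, P f -> P g -> P (addF f g),
      forall f g, P g -> P (mulF f g) &
      forall f g, P f -> P (mulF f g)].
Definition genIdealF (G : elF -> Prop) (f : elF) :=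
  forall P, idealF P -> (forall g, G g -> P g) -> P f.

Definition relXp : elF := [:: ([:: gH; gXp], 1); ([:: gXp; gH], -1); ([:: gXp], -2)].
Definition relXm : elF := [:: ([:: gH; gXm], 1); ([:: gXm; gH], -1); ([:: gXm], 2)].
Definition relSl2 : elF := [:: ([:: gXp; gXm], 1); ([:: gXm; gXp], -1); ([:: gH], -1)].

Definition relsA (f : elF) := f = relXp \/ f = relXm.
Definition relsSl2 (f : elF) := [\/ f = relXp, f = relXm | f = relSl2].

Definition elS := nat -> elF.
Definition coefS (x : elS) (m : nat) (w : word) : K := coefF (x m) w.
Definition eqvS (x y : elS) := forall m w, coefS x m w = coefS y m w.
Definition zeroS : elS := fun _ => [::].
Definition oneS : elS := fun m => if m is 0%N then [:: ([::], 1)] else [::].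
Definition addS (x y : elS) : elS := fun m => addF (x m) (y m).
Definition oppS (x : elS) : elS := fun m => oppF (x m).
Definition subS (x y : elS) : elS := addS x (oppS y).
Definition mulS (x y : elS) : elS :=
  fun m => flatten [seq mulF (x i) (y (m - i)%N) | i <- iota 0 m.+1].
Definition scalS (c : serK) : elS := fun m => [:: ([::], c m)].
Definition genS (g : 'I_3) : elS := fun m => if m is 0%N then [:: ([:: g], 1)] else [::].

Definition idealS (P : elS -> Prop) :=
  [/\ forall x y, eqvS x y -> P x -> P y,
      P zeroS,
      forall x y, P x -> P y -> P (addS x y),
      forall x y, P y -> P (mulS x y) &
      forall x y, P x -> P (mulS x y)].
Definition hclosedS (P : elS -> Prop) :=
  forall x, (forall N, exists y, P y /\ forall m w, (m < N)%N -> coefS x m w = coefS y m w)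
            -> P x.
Definition genClosedIdealS (G : elS -> Prop) (x : elS) :=
  forall P, idealS P -> hclosedS P -> (forall g, G g -> P g) -> P x.

(* kernel of F[[h]] -> U(a)[[h]] = U_h(a) : coefficientwise in the ideal of a *)
Definition kerUha (x : elS) := forall m, genIdealF relsA (x m).
Definition kerUsl2h (x : elS) := forall m, genIdealF relsSl2 (x m).

(* (q^H - q^{-H}) / h  with q^H = exp(hH):
   coefficient of h^m is (1 - (-1)^(m+1)) H^(m+1) / (m+1)! *)
Definition qHdiffh : elS :=
  fun m => [:: (nseq m.+1 gH, (1 - (-1) ^+ m.+1) / (m.+1)`!%:R)].
Definition relQ : elS :=
  subS (subS (mulS (genS gXp) (genS gXm)) (mulS (genS gXm) (genS gXp)))
       (mulS (scalS (invK (qdiffh 1))) qHdiffh).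
Definition kerUhsl2 (x : elS) := genClosedIdealS (fun y => kerUha y \/ y = relQ) x.

(* V = (\oplus_k k b_k)[[h]]; \oplus_k k b_k is modelled by {poly K}
   (coefficient j <-> coordinate on b_j). *)
Definition elV := nat -> {poly K}.
Definition actH (n : int) (v : elV) : elV :=
  fun i => \poly_(j < size (v i)) ((n - (j.*2)%:Z)%:~R * (v i)`_j).
Definition actXm (v : elV) : elV := fun i => 'X * v i.
Definition actXp (psi : colourfun) (n : int) (v : elV) : elV :=
  fun p => \sum_(i < p.+1) \poly_(j < size (v i)) (psi j.+1 n (p - i)%N * (v i)`_j.+1).
Definition actG (psi : colourfun) (n : int) (g : 'I_3) (v : elV) : elV :=
  match val g with 0%N => actH n v | 1%N => actXm v | _ => actXp psi n v end.
Definition actW (psi : colourfun) (n : int) (w : word) (v : elV) : elV :=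
  foldr (actG psi n) v w.
Definition actS (psi : colourfun) (n : int) (x : elS) (v : elV) : elV :=
  fun p => \sum_(m < p.+1) \sum_(t <- x m) t.2 *: actW psi n t.1 v (p - m)%N.

Definition kerUhpsi (psi : colourfun) (x : elS) :=
  forall (n : int) (v : elV) (p : nat), actS psi n x v p = 0.

(* For quotients A1 = F[[h]]/K1 and A2 = F[[h]]/K2 (both receiving U_h(a) via the
   projection), an isomorphism of U_h(a)-algebras A1 -> A2, given on
   representatives by phi. *)
Definition isoUhaAlg (K1 K2 : elS -> Prop) :=
  exists phi : elS -> elS,
    (forall x y, K1 (subS x y) <-> K2 (subS (phi x) (phi y))) /\
    (forall y, exists x, K2 (subS (phi x) y)) /\
    (forall x y, K2 (subS (phi (addS x y)) (addS (phi x) (phi y)))) /\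
    (forall x y, K2 (subS (phi (mulS x y)) (mulS (phi x) (phi y)))) /\
    K2 (subS (phi oneS) oneS) /\
    (forall c x, K2 (subS (phi (mulS (scalS c) x)) (mulS (scalS c) (phi x)))) /\
    (forall x, K2 (subS (phi x) x)).

End Defs.

(* Main.v *)
Require Import Defs.
From HB Require Import structures.
From mathcomp Require Import all_boot all_order all_algebra.
From mathcomp Require Import ring.
From Stdlib Require Import FunctionalExtensionality.
Import GRing.Theory.
Local Open Scope ring_scope.
Set Implicit Arguments. Unset Strict Implicit. Unset Printing Implicit Defensive.

(** All the algebras involved are quotients of F[[h]], F the free algebra on
    H, X^-, X^+, so it suffices to compare kernels.  Modulo the relations of
    sl_2 every element of F is a combination of monomials (X^-)^a H^b (X^+)^d,
    and such a combination acting by zero on all Verma modules V(n) vanishes.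
    This settles the natural colouring coefficientwise.  For the q-colouring,
    the relation of U_h(sl_2) acts by zero because
    [k+1][n-k] - [k][n-k+1] = [n-2k].  Conversely, if x acts by zero then so
    does x mod h on the classical Verma modules, so x is congruent mod h to an
    element of the closed ideal; subtracting it, dividing by h and iterating
    approximates x h-adically by elements of that ideal. *)

(** Both sides run over all triples of naturals with sum [p]. This is the associativity of Cauchy
    products, used for series of scalars, of algebra elements and of operators. *)
Lemma big_triangle_reindex (V : nmodType) (F : nat -> nat -> nat -> V) p :
  \sum_(m < p.+1) \sum_(i < m.+1) F i (m - i)%N (p - m)%N =
  \sum_(i < p.+1) \sum_(j < (p - i).+1) F i j (p - i - j)%N.
Proof.
transitivity (\sum_(m < p.+1) \sum_(i < p.+1 | (i <= m)%N)
                F i (m - i)%N (p - m)%N).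
  apply: eq_bigr => m _.
  by rewrite (big_ord_widen p.+1 (fun i => F i (m - i)%N (p - m)%N)).
rewrite (exchange_big_dep xpredT) //=; apply: eq_bigr => i _.
rewrite -(big_mkord (fun m => (i <= m)%N) (fun m => F i (m - i)%N (p - m)%N)).
have lip : (i <= p)%N by rewrite -ltnS.
rewrite -(big_nat_widenl i 0 p.+1 xpredT) // -{1}[i : nat]add0n big_addn.
rewrite subSn // big_mkord.
by apply: eq_bigr => j _; rewrite addnK addnC subnDA.
Qed.

(** * Linear extension from words to the free algebra *)

Section FreeAlgebra.
Variable K : fieldType.
Implicit Types (f g : elF K) (w : word) (x y : elS K).

(** The linear extension of [G] to F. Coefficients and actions are written through it, so that
    [evalF_eqv] makes them independent of the list representing an element. *)
Definition evalF (V : lmodType K) (G : word -> V) f : V :=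
  \sum_(t <- f) t.2 *: G t.1.

Lemma coefF_add f g w : coefF (addF f g) w = coefF f w + coefF g w.
Proof. exact: big_cat. Qed.

Lemma coefF_opp f w : coefF (oppF f) w = - coefF f w.
Proof. by rewrite /coefF big_map /= -sumrN. Qed.

Lemma coefF_nil w : coefF [::] w = 0 :> K.
Proof. exact: big_nil. Qed.

Lemma coefF_cons (t : word * K) f w :
  coefF (t :: f) w = (t.1 == w)%:R * t.2 + coefF f w.
Proof. by rewrite /coefF big_cons; case: eqP; rewrite ?mul1r // mul0r add0r. Qed.

Lemma evalF_support (V : lmodType K) (G : word -> V) f (s : seq word) :
  uniq s -> {subset map fst f <= s} ->
  evalF G f = \sum_(w <- s) coefF f w *: G w.
Proof.
move=> us sub; rewrite /evalF.
under [RHS]eq_bigr => w _ do rewrite /coefF scaler_suml.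
rewrite [RHS](exchange_big_dep xpredT) //= big_seq [RHS]big_seq.
apply: eq_bigr => t tf; rewrite big_mkcond (bigD1_seq t.1) //=; last first.
  by apply: sub; apply: map_f.
by rewrite eqxx big1 ?addr0 // => w; rewrite eq_sym => /negbTE ->.
Qed.

Lemma evalF_eqv (V : lmodType K) (G : word -> V) f g :
  eqvF f g -> evalF G f = evalF G g.
Proof.
(* Both lists are expanded over one common duplicate-free support. *)
move=> fg; pose s := undup (map fst f ++ map fst g).
rewrite (@evalF_support _ _ f s) ?undup_uniq //; last first.
  by move=> w wf; rewrite mem_undup mem_cat wf.
rewrite (@evalF_support _ _ g s) ?undup_uniq //; last first.
  by move=> w wf; rewrite mem_undup mem_cat wf orbT.
by apply: eq_bigr => w _; rewrite fg.
Qed.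

Lemma coefF_evalF f w : coefF f w = evalF (fun u => (u == w)%:R : K^o) f.
Proof.
rewrite /coefF /evalF big_mkcond; apply: eq_bigr => t _.
by case: eqP => _; [exact/esym/mulr1 | exact/esym/mulr0].
Qed.

Lemma evalF_add (V : lmodType K) (G : word -> V) f g :
  evalF G (addF f g) = evalF G f + evalF G g.
Proof. exact: big_cat. Qed.

Lemma evalF_opp (V : lmodType K) (G : word -> V) f :
  evalF G (oppF f) = - evalF G f.
Proof.
by rewrite /evalF big_map -sumrN; apply: eq_bigr => t _; rewrite scaleNr.
Qed.

Lemma evalF_mul (V : lmodType K) (G : word -> V) f g :
  evalF G (mulF f g) =
  \sum_(t <- f) \sum_(u <- g) (t.2 * u.2) *: G (t.1 ++ u.1).
Proof. by rewrite /evalF big_allpairs_dep. Qed.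

Definition constS f : elS K := fun m => if m is 0 then f else [::].

Lemma mulS_constS f g : eqvS (mulS (constS f) (constS g)) (constS (mulF f g)).
Proof.
case=> [|m] w; rewrite /coefS /mulS.
  by rewrite /= cats0.
rewrite /coefF big_flatten big_map big1 ?big_nil // => -[|i] _ /=.
  by rewrite /mulF big1_seq // => t; rewrite allpairs0r andbF.
by rewrite big_nil.
Qed.

(** Contracting an ideal of F[[h]] to F gives an ideal, at which the quantifier in [genIdealF] can
    then be instantiated. *)
Lemma idealS_constS (P : elS K -> Prop) :
  idealS P -> idealF (fun f => P (constS f)).
Proof.
case=> Peq P0 Padd Pl Pr; split.
- by move=> f g fg; apply: Peq => -[|m] w //=; apply: fg.
- by apply: Peq P0 => -[].
- by move=> f g Pf Pg; apply: Peq (Padd _ _ Pf Pg) => -[].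
- by move=> f g Pg; apply: Peq (Pl (constS f) _ Pg); apply: mulS_constS.
- by move=> f g Pf; apply: Peq (Pr _ (constS g) Pf); apply: mulS_constS.
Qed.

End FreeAlgebra.

(** * The action of F[[h]] on the representation *)

Section Representation.
Variables (K : fieldType) (psi : colourfun K) (n : int).

(** The infinite combination of the [V u] in which terms listed in [s m] carry the factor h^m;
    [actS] itself has this shape. Commuting with such combinations, as in [hlinear], is what makes
    [actS] multiplicative. *)
Definition hcomb (I : Type) (s : nat -> seq I) (c : I -> K) (V : I -> elV K) :
  elV K := fun p => \sum_(m < p.+1) \sum_(u <- s m) c u *: V u (p - m)%N.

Definition hlinear (T : elV K -> elV K) := forall I (s : nat -> seq I) c V,
  T (hcomb s c V) = hcomb s c (fun u => T (V u)).

Lemma coef_actH (v : elV K) p j :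
  (actH n v p)`_j = (n - (j.*2)%:Z)%:~R * (v p)`_j.
Proof.
rewrite coef_poly; case: ltnP => // szj.
by rewrite [in RHS]nth_default // mulr0.
Qed.

Lemma coef_actXm (v : elV K) p j :
  (actXm v p)`_j = if j is j'.+1 then (v p)`_j' else 0.
Proof. by rewrite /actXm coefXM; case: j. Qed.

Lemma coef_actXp (v : elV K) p j :
  (actXp psi n v p)`_j = \sum_(i < p.+1) psi j.+1 n (p - i)%N * (v i)`_j.+1.
Proof.
rewrite /actXp coef_sum; apply: eq_bigr => i _.
rewrite coef_poly; case: ltnP => // szj.
by rewrite nth_default ?mulr0 // (leq_trans szj).
Qed.

Lemma coef_hcomb I (s : nat -> seq I) c V p j :
  (hcomb s c V p)`_j =
  \sum_(m < p.+1) \sum_(u <- s m) c u * (V u (p - m)%N)`_j.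
Proof.
rewrite coef_sum; apply: eq_bigr => m _; rewrite coef_sum.
by apply: eq_bigr => u _; rewrite coefZ.
Qed.

Lemma actG_hlinear g : hlinear (actG psi n g).
Proof.
case: g => [[|[|[|//]]] ?] I s c V; apply: functional_extensionality => p;
  apply/polyP => j; rewrite /actG /= coef_hcomb.
- rewrite coef_actH coef_hcomb mulr_sumr; apply: eq_bigr => m _.
  rewrite mulr_sumr; apply: eq_bigr => u _.
  by rewrite coef_actH mulrCA.
- rewrite coef_actXm; case: j => [|j].
    by rewrite big1 // => m _; rewrite big1 // => u _; rewrite coef_actXm mulr0.
  rewrite coef_hcomb; apply: eq_bigr => m _; apply: eq_bigr => u _.
  by rewrite coef_actXm.
rewrite coef_actXp.
(* Only X^+ has a coefficient that is a power series in h, hence a second Cauchy product to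
   interchange with the first. *)
pose F m a b := \sum_(u <- s m) c u * (psi j.+1 n b * (V u a)`_j.+1).
transitivity (\sum_(i < p.+1) \sum_(m < i.+1) F m (i - m)%N (p - i)%N).
  apply: eq_bigr => i _; rewrite coef_hcomb mulr_sumr; apply: eq_bigr => m _.
  rewrite mulr_sumr; apply: eq_bigr => u _; exact: mulrCA.
rewrite big_triangle_reindex; apply: eq_bigr => m _.
rewrite exchange_big; apply: eq_bigr => u _.
by rewrite coef_actXp mulr_sumr.
Qed.

Lemma actW_hlinear w : hlinear (actW psi n w).
Proof.
elim: w => [|g w IHw] I s c V //=.
by rewrite IHw actG_hlinear.
Qed.

Lemma actS_evalF (x : elS K) v p :
  actS psi n x v p =
  \sum_(m < p.+1) evalF (fun w => actW psi n w v (p - m)%N) (x m).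
Proof. by []. Qed.

Lemma actS_eqv_upto (x y : elS K) v p :
  (forall m w, (m <= p)%N -> coefS x m w = coefS y m w) ->
  actS psi n x v p = actS psi n y v p.
Proof.
move=> xy; rewrite !actS_evalF; apply: eq_bigr => m _.
by apply: evalF_eqv => w; apply: xy; rewrite -ltnS.
Qed.

Lemma actS_add (x y : elS K) v p :
  actS psi n (addS x y) v p = actS psi n x v p + actS psi n y v p.
Proof.
rewrite !actS_evalF -big_split; apply: eq_bigr => m _; exact: evalF_add.
Qed.

Lemma actS_opp (x : elS K) v p :
  actS psi n (oppS x) v p = - actS psi n x v p.
Proof.
rewrite !actS_evalF -sumrN; apply: eq_bigr => m _; exact: evalF_opp.
Qed.

Lemma actS_mul (x y : elS K) v :
  actS psi n (mulS x y) v = actS psi n x (actS psi n y v).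
Proof.
apply: functional_extensionality => p.
pose F i j k := \sum_(t <- x i) \sum_(u <- y j)
  (t.2 * u.2) *: actW psi n (t.1 ++ u.1) v k.
transitivity (\sum_(m < p.+1) \sum_(i < m.+1) F i (m - i)%N (p - m)%N).
  rewrite actS_evalF; apply: eq_bigr => m _.
  rewrite /evalF /mulS big_flatten big_map -[m.+1]subn0.
  rewrite -/(index_iota 0 m.+1) big_mkord subn0; apply: eq_bigr => i _.
  exact: (evalF_mul (fun w => actW psi n w v (p - m)%N)).
rewrite big_triangle_reindex; apply: eq_bigr => i _.
rewrite exchange_big; apply: eq_bigr => t _.
(* Each word acts h-linearly, so it passes inside the series defining the action of [y]. *)
have -> : actW psi n t.1 (actS psi n y v) =
    hcomb y snd (fun u => actW psi n t.1 (actW psi n u.1 v)).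
  exact: actW_hlinear.
rewrite /hcomb scaler_sumr; apply: eq_bigr => j _.
rewrite scaler_sumr; apply: eq_bigr => u _.
by rewrite scalerA /actW foldr_cat.
Qed.

Lemma actS_constS f v p :
  actS psi n (constS f) v p = evalF (fun w => actW psi n w v p) f.
Proof.
rewrite actS_evalF big_ord_recl subn0 big1 ?addr0 // => i _.
exact: big_nil.
Qed.

Lemma actS0 (x : elS K) p :
  actS psi n x (fun _ => 0) p = 0.
Proof.
(* Writing zero as an empty combination lets h-linearity show that words preserve it. *)
have -> : (fun _ => 0) = hcomb (fun _ => [::]) snd (fun u : K * K => fun _ => 0).
  apply: functional_extensionality => q; rewrite /hcomb big1 // => i _.
  by rewrite big_nil.
rewrite actS_evalF big1 // => m _; rewrite /evalF big1 // => t _.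
by rewrite actW_hlinear /hcomb big1 ?scaler0 // => i _; rewrite big_nil.
Qed.

End Representation.

(** * Structure of the kernel of the action *)

Section Kernel.
Variables (K : fieldType) (psi : colourfun K).
Implicit Types (x y : elS K).

Lemma kerUhpsi_ideal : idealS (kerUhpsi psi).
Proof.
split.
- move=> x y xy kx n v p; rewrite -(kx n v p); apply: actS_eqv_upto => m w _.
  exact/esym/xy.
- by move=> n v p; rewrite actS_evalF big1 // => m _; apply: big_nil.
- by move=> x y kx ky n v p; rewrite actS_add kx ky addr0.
- move=> x y ky n v p; rewrite actS_mul.
  have -> : actS psi n y v = fun _ => 0.
    by apply: functional_extensionality => q; apply: ky.
  exact: actS0.
- by move=> x y kx n v p; rewrite actS_mul kx.
Qed.

(** The coefficient of h^p in the action of [x] depends on [x] only modulo h^(p+1). *)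
Lemma kerUhpsi_hclosed : hclosedS (kerUhpsi psi).
Proof.
move=> x hx n v p; have [y [ky xy]] := hx p.+1.
by rewrite -(ky n v p); apply: actS_eqv_upto => m w mp; apply: xy.
Qed.

Lemma kerUhpsi_genIdealF (R : elF K -> Prop) x :
  (forall r, R r -> kerUhpsi psi (constS r)) ->
  (forall m, genIdealF R (x m)) -> kerUhpsi psi x.
Proof.
move=> kR Rx n v p; rewrite actS_evalF big1 // => m _.
rewrite -actS_constS.
exact: (Rx m _ (idealS_constS kerUhpsi_ideal) kR).
Qed.

(** Here [psi] is arbitrary: b_j has weight n - 2j, and X^+ and X^- move j by one step whatever the
    scalar. *)
Lemma kerUhpsi_relsA r : relsA r -> kerUhpsi psi (constS r).
Proof.
move=> rA n v p; rewrite actS_constS /evalF; apply/polyP => j; rewrite coef0.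
case: rA => ->; rewrite !big_cons big_nil /= addr0 !coefD !coefZ /actG /=.
- rewrite coef_actH !coef_actXp !mulr_sumr -!big_split big1 // => i _ /=.
  rewrite coef_actH !rmorphB /= doubleS -addn2 PoszD rmorphD /=; ring.
- rewrite coef_actH !coef_actXm; case: j => [|j]; first by ring.
  rewrite coef_actH !rmorphB /= doubleS -addn2 PoszD rmorphD /=; ring.
Qed.

(** The representation has no h-torsion, so a kernel element divisible by h may be divided by h. *)
Lemma kerUhpsi_shift x :
  kerUhpsi psi x -> eqvF (x 0%N) [::] -> kerUhpsi psi (fun m => x m.+1).
Proof.
move=> kx x0 n v p; rewrite -[RHS](kx n v p.+1) [RHS]actS_evalF big_ord_recl.
rewrite (evalF_eqv _ x0) [evalF _ _]big_nil add0r.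
by apply: eq_bigr => i _; rewrite /evalF lift0 subSS.
Qed.

End Kernel.

(** * Ordered monomials span modulo the relations of sl_2 *)

Section Spanning.
Variable K : fieldType.
Implicit Types (f g : elF K) (w : word) (c : K).

Definition pbw (a b d : nat) : word :=
  nseq a gXm ++ nseq b gH ++ nseq d gXp.
(** Rebuilding the word from its letter counts makes the test decidable and the exponents
    recoverable. *)
Definition is_pbw w :=
  w == pbw (count_mem gXm w) (count_mem gH w) (count_mem gXp w).

Lemma count_pbw a b d :
  [/\ count_mem gXm (pbw a b d) = a, count_mem gH (pbw a b d) = b
    & count_mem gXp (pbw a b d) = d].
Proof. by rewrite /pbw !count_cat !count_nseq /= !mul1n !mul0n !addn0. Qed.

Lemma pbw_is_pbw a b d : is_pbw (pbw a b d).
Proof. by rewrite /is_pbw; case: (count_pbw a b d) => -> -> ->. Qed.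

Local Notation I := (genIdealF (@relsSl2 K)).

Lemma genIdealF_ideal (R : elF K -> Prop) : idealF (genIdealF R).
Proof.
split.
- move=> f g fg If P Pid PR; case: (Pid) => Peq _ _ _ _.
  exact: Peq fg (If _ Pid PR).
- by move=> P [].
- move=> f g If Ig P Pid PR; case: (Pid) => _ _ Padd _ _.
  by apply: Padd; [apply: If | apply: Ig].
- move=> f g Ig P Pid PR; case: (Pid) => _ _ _ Pl _.
  by apply: Pl; apply: Ig.
- move=> f g If P Pid PR; case: (Pid) => _ _ _ _ Pr.
  by apply: Pr; apply: If.
Qed.

Lemma coefF_scale c f w : coefF (mulF [:: ([::], c)] f) w = c * coefF f w.
Proof.
rewrite /coefF /mulF /= cats0 big_map mulr_sumr.
exact: eq_bigl.
Qed.

Definition spanned f := exists2 g, all is_pbw (map fst g) & I (addF f (oppF g)).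

Lemma spanned_cong f f' : I (addF f (oppF f')) -> spanned f' -> spanned f.
Proof.
have [Ieq I0 Iadd Il Ir] := genIdealF_ideal (@relsSl2 K).
move=> ff' [g ng f'g]; exists g => //.
apply: Ieq (Iadd _ _ ff' f'g) => w; rewrite !coefF_add !coefF_opp; ring.
Qed.

Lemma spanned_eqv f f' : eqvF f f' -> spanned f' -> spanned f.
Proof.
have [Ieq I0 Iadd Il Ir] := genIdealF_ideal (@relsSl2 K).
move=> ff'; apply: spanned_cong; apply: Ieq I0 => w.
by rewrite !coefF_add !coefF_opp ff' subrr coefF_nil.
Qed.

Lemma spanned_add f g : spanned f -> spanned g -> spanned (addF f g).
Proof.
have [Ieq I0 Iadd Il Ir] := genIdealF_ideal (@relsSl2 K).
move=> [f' nf' ff'] [g' ng' gg']; exists (addF f' g').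
  by rewrite map_cat all_cat nf'.
apply: Ieq (Iadd _ _ ff' gg') => w; rewrite !(coefF_add, coefF_opp); ring.
Qed.

Lemma spanned_scale c f : spanned f -> spanned (mulF [:: ([::], c)] f).
Proof.
have [Ieq I0 Iadd Il Ir] := genIdealF_ideal (@relsSl2 K).
move=> [g ng fg]; exists (mulF [:: ([::], c)] g).
  by rewrite /mulF /= cats0 -map_comp.
apply: Ieq (Il [:: ([::], c)] _ fg) => w.
rewrite coefF_scale coefF_add coefF_opp coefF_add coefF_opp !coefF_scale.
exact: mulrBr.
Qed.

Lemma spanned_pbw a b d c : spanned [:: (pbw a b d, c)].
Proof.
have [Ieq I0 Iadd Il Ir] := genIdealF_ideal (@relsSl2 K).
exists [:: (pbw a b d, c)]; first by rewrite /= pbw_is_pbw.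
by apply: Ieq I0 => w; rewrite coefF_add coefF_opp subrr coefF_nil.
Qed.

Lemma spanned_nil : spanned [::].
Proof. by exists [::] => // P []. Qed.

Definition lgen (g : 'I_3) f := mulF [:: ([:: g], 1 : K)] f.

Lemma lgen_cons e t f : lgen e (t :: f) = (e :: t.1, t.2) :: lgen e f.
Proof. by rewrite /lgen /mulF /= mul1r. Qed.

Lemma coefF_lgen e f w :
  coefF (lgen e f) w = if w is u :: w' then (e == u)%:R * coefF f w' else 0.
Proof.
elim: f => [|t f IHf].
  by rewrite coefF_nil; case: w => // *; rewrite coefF_nil mulr0.
rewrite lgen_cons coefF_cons IHf; case: w {IHf} => [|u w] /=.
  by rewrite mul0r addr0.
by rewrite coefF_cons eqseq_cons; case: eqP => _ /=; rewrite ?mul1r ?mul0r ?addr0.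
Qed.

(** Left multiplication is linear and respects the ideal, so only single ordered monomials need
    checking. *)
Lemma spanned_lgen e :
  (forall a b d, spanned [:: (e :: pbw a b d, 1)]) ->
  forall f, spanned f -> spanned (lgen e f).
Proof.
have [Ieq I0 Iadd Il Ir] := genIdealF_ideal (@relsSl2 K).
move=> epbw f [f' nf' ff']; apply: (@spanned_cong _ (lgen e f')).
  apply: Ieq (Il [:: ([:: e], 1)] _ ff') => w.
  rewrite [LHS](coefF_lgen e) coefF_add coefF_opp !coefF_lgen.
  by case: w => [|u w]; rewrite ?subrr // !(coefF_add, coefF_opp) mulrBr.
elim: f' nf' {ff'} => [|t f' IHf] /=; first by move=> _; apply: spanned_nil.
move=> /andP[/eqP nt /IHf{IHf} sf']; rewrite lgen_cons.
apply: (@spanned_add [:: _]) => //.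
apply: (spanned_eqv _ (spanned_scale t.2 (epbw (count_mem gXm t.1)
  (count_mem gH t.1) (count_mem gXp t.1)))) => w.
by rewrite -nt coefF_scale !coefF_cons coefF_nil /=; ring.
Qed.

Lemma spanned_lXm f : spanned f -> spanned (lgen gXm f).
Proof. by apply: spanned_lgen => a b d; apply: (spanned_pbw a.+1). Qed.

Lemma genIdealF_rel r w : relsSl2 r -> I (mulF r [:: (w, 1)]).
Proof.
have [_ _ _ _ Ir] := genIdealF_ideal (@relsSl2 K).
by move=> Rr; apply: Ir => P _; apply.
Qed.

Lemma spanned_lH f : spanned f -> spanned (lgen gH f).
Proof.
have [Ieq I0 Iadd Il Ir] := genIdealF_ideal (@relsSl2 K).
apply: spanned_lgen => a b d; elim: a => [|a IHa].
  exact: (spanned_pbw 0 b.+1 d).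
(* Uses H X^- = X^- H - 2 X^-. *)
apply: spanned_cong (spanned_add (spanned_lXm IHa)
  (spanned_scale (-2) (spanned_pbw a.+1 b d 1))).
apply: Ieq (@genIdealF_rel (relXm K) (pbw a b d) _) => [w|]; last by constructor.
rewrite /mulF /addF /oppF /lgen /= !coefF_cons coefF_nil /=; ring.
Qed.

Lemma spanned_lXp f : spanned f -> spanned (lgen gXp f).
Proof.
have [Ieq I0 Iadd Il Ir] := genIdealF_ideal (@relsSl2 K).
apply: spanned_lgen => a b d; elim: a => [|a IHa].
  elim: b => [|b IHb]; first exact: (spanned_pbw 0 0 d.+1).
  (* Without X^- in front, X^+ moves past H by X^+ H = H X^+ - 2 X^+. *)
  apply: spanned_cong (spanned_add (spanned_lH IHb) (spanned_scale (-2) IHb)).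
  have rXp := @genIdealF_rel (relXp K) (pbw 0 b d) (Or31 _ _ erefl).
  apply: Ieq (Il [:: ([::], -1)] _ rXp) => w.
  rewrite coefF_scale.
  rewrite /mulF /addF /oppF /lgen /= !coefF_cons coefF_nil /=; ring.
(* Uses X^+ X^- = X^- X^+ + H. *)
apply: spanned_cong (spanned_add (spanned_lXm IHa)
  (spanned_lH (spanned_pbw a b d 1))).
apply: Ieq (@genIdealF_rel (relSl2 K) (pbw a b d) _) => [w|]; last by constructor.
rewrite /mulF /addF /oppF /lgen /= !coefF_cons coefF_nil /=; ring.
Qed.

Lemma spanned_all f : spanned f.
Proof.
elim: f => [|[w c] f IHf]; first exact: spanned_nil.
apply: (@spanned_add [:: _]) => //.
elim: w => [|g w IHw]; first exact: (spanned_pbw 0 0 0).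
have -> : [:: (g :: w, c)] = lgen g [:: (w, c)] by rewrite lgen_cons.
case: g => [[|[|[|//]]] i].
- by rewrite (_ : Ordinal i = gH); [apply: spanned_lH | apply: val_inj].
- by rewrite (_ : Ordinal i = gXm); [apply: spanned_lXm | apply: val_inj].
- by rewrite (_ : Ordinal i = gXp); [apply: spanned_lXp | apply: val_inj].
Qed.

End Spanning.

(** * Classical Verma modules and the natural colouring *)

Section Verma.
Variable K : fieldType.
Implicit Types (n : int) (u : {poly K}) (w : word) (f : elF K).

(** The generators acting on the classical Verma module over K, obtained as the h^0 part of the
    natural action. *)
Definition vG n (e : 'I_3) u : {poly K} :=
  actG (@natColouring K) n e (fun _ => u) 0%N.
Definition vW n w u := foldr (vG n) u w.

Lemma actG_const_term (psi : colourfun K) n e v :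
  (forall k, psi k n 0%N = natColouring K k n 0%N) ->
  actG psi n e v 0%N = vG n e (v 0%N).
Proof.
move=> psi0; apply/polyP => j; rewrite /vG /actG.
case: e => [[|[|[|//]]] ?] /=; rewrite ?coef_actH ?coef_actXm //.
by rewrite !coef_actXp !big_ord1 psi0.
Qed.

Lemma actW_const_term (psi : colourfun K) n w v :
  (forall k, psi k n 0%N = natColouring K k n 0%N) ->
  actW psi n w v 0%N = vW n w (v 0%N).
Proof.
by move=> psi0; elim: w => //= e w IHw; rewrite actG_const_term // IHw.
Qed.

Lemma actW_nat n w v p : actW (@natColouring K) n w v p = vW n w (v p).
Proof.
elim: w => //= e w <-; move: (actW _ _ _ _) => {}v.
apply/polyP => j; rewrite /vG /actG.
case: e => [[|[|[|//]]] ?] /=; rewrite ?coef_actH ?coef_actXm //.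
rewrite !coef_actXp big_ord1 big_ord_recr /= subnn big1 ?add0r // => i _.
(* For [i < p] the index [p - i] is a successor, where [natColouring] vanishes. *)
by rewrite -(subnSK (ltn_ord i)) mul0r.
Qed.

(** The scalar by which (X^+)^d sends b_d to b_0. *)
Definition fallN d n : K := \prod_(i < d) natColouring K i.+1 n 0%N.

Lemma vG_Xp_monomial n c k :
  vG n gXp (c *: 'X^(k.+1)) = (c * natColouring K k.+1 n 0%N) *: 'X^k.
Proof.
apply/polyP => j; rewrite /vG /actG /= coef_actXp big_ord1 !coefZ !coefXn.
by rewrite eqSS; case: eqP => [->|_]; rewrite ?mulr0 // !mulr1 mulrC.
Qed.

Lemma vG_Xp_const n c : vG n gXp c%:P = 0.
Proof.
apply/polyP => j; rewrite /vG /actG /= coef_actXp big_ord1 coefC.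
by rewrite mulr0 coef0.
Qed.

Lemma vG_H_const n c : vG n gH c%:P = (c * n%:~R)%:P.
Proof.
apply/polyP => -[|j]; rewrite /vG /actG /= coef_actH !coefC /=.
  by rewrite subr0 mulrC.
by rewrite mulr0.
Qed.

Lemma vG0 n e : vG n e 0 = 0.
Proof.
apply/polyP => j; rewrite /vG /actG coef0.
case: e => [[|[|[|//]]] ?] /=.
- by rewrite coef_actH coef0 mulr0.
- by rewrite coef_actXm; case: j => // j; rewrite coef0.
- by rewrite coef_actXp big_ord1 coef0 mulr0.
Qed.

Lemma vW0 n w : vW n w 0 = 0.
Proof. by elim: w => //= e w ->; rewrite vG0. Qed.

Lemma vW_nseq n k e u : vW n (nseq k e) u = iter k (vG n e) u.
Proof. by elim: k => //= k ->. Qed.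

Lemma iter_Xp n d c : iter d (vG n gXp) (c *: 'X^d) = (c * fallN d n)%:P.
Proof.
rewrite /fallN; elim: d c => [|d IHd] c /=.
  by rewrite big_ord0 mulr1 expr0 alg_polyC.
rewrite -iterS iterSr vG_Xp_monomial IHd big_ord_recr -mulrA.
by rewrite [X in c * X]mulrC.
Qed.

Lemma vW_cat n w1 w2 u : vW n (w1 ++ w2) u = vW n w1 (vW n w2 u).
Proof. exact: foldr_cat. Qed.

(** First (X^+)^d brings b_d down to b_0, then H acts there by n, and (X^-)^a raises the result to
    b_a. *)
Lemma vW_pbw n a b d :
  vW n (pbw a b d) 'X^d = (fallN d n * n%:~R ^+ b) *: 'X^a.
Proof.
rewrite /pbw !vW_cat !vW_nseq -['X^d]scale1r iter_Xp mul1r.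
elim: a => [|a IHa] /=.
  elim: b => [|b IHb]; first by rewrite expr0 mulr1 alg_polyC.
  by rewrite iterS IHb !alg_polyC vG_H_const exprSr mulrA.
by rewrite IHa /vG /actG /= /actXm exprS -scalerAr.
Qed.

(** The first k+1 factors X^+ to act already kill b_k. *)
Lemma vW_pbw_gt n a b d k : (k < d)%N -> vW n (pbw a b d) 'X^k = 0.
Proof.
move=> lt_kd; rewrite /pbw !vW_cat [X in vW _ _ (vW _ _ X)](_ : _ = 0) ?vW0 //.
rewrite -(subnK lt_kd) nseqD vW_cat [X in vW _ _ X](_ : _ = 0) ?vW0 //.
by rewrite vW_nseq iterS -['X^k]scale1r iter_Xp vG_Xp_const.
Qed.

Hypothesis char0 : [pchar K] =i pred0.

Lemma natr_eq0_char0 m : (m%:R == 0 :> K) = (m == 0)%N.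
Proof. by have /pcharf0P := char0. Qed.

Lemma natr_inj_char0 : injective (fun m : nat => m%:R : K).
Proof.
move=> i j /eqP; wlog le_ij : i j / (i <= j)%N.
  move=> H; case/orP: (leq_total i j) => h e; [|apply/esym]; apply: H => //.
  by rewrite eq_sym.
rewrite eq_sym -subr_eq0 -natrB // natr_eq0_char0 subn_eq0 => le_ji.
by apply/eqP; rewrite eqn_leq le_ij.
Qed.

(** At n = d + m each factor is (i+1)(d+m-i) with i < d, a positive natural number. *)
Lemma fallN_neq0 d m : fallN d (d + m)%:Z != 0.
Proof.
apply/prodf_neq0 => i _; rewrite /natColouring.
have -> : (i.+1%:Z * ((d + m)%:Z - i.+1%:Z + 1) = (i.+1 * (d + m - i))%N%:Z)%R.
  rewrite PoszM -subzn; last by rewrite ltnW // ltn_addr.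
  by rewrite -addn1 PoszD; ring.
rewrite -[_%:~R]/(_%:R) natr_eq0_char0 muln_eq0 subn_eq0 negb_or /=.
by rewrite -ltnNge ltn_addr.
Qed.

Lemma poly_nat_roots (p : {poly K}) d :
  (forall m, p.[(d + m)%N%:R] = 0) -> p = 0.
Proof.
move=> p0; apply/eqP; apply/negPn/negP => nzp.
pose s := [seq (d + m)%N%:R : K | m <- iota 0 (size p)].
have := max_poly_roots nzp (rs := s).
rewrite size_map size_iota ltnn => H; suff: false by []; apply: H.
- by apply/allP => _ /mapP[m _ ->]; apply/eqP.
- rewrite map_inj_uniq ?iota_uniq // => i j /natr_inj_char0.
  exact: addnI.
Qed.

(* Lowest degree in X^+ first: applied to b_d, the terms of higher degree in
   X^+ die and those of degree d are read off as polynomials in n. *)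
Lemma pbw_coef_eq0 f :
  all is_pbw (map fst f) ->
  (forall n u, evalF (fun w => vW n w u) f = 0) ->
  forall d a b, coefF f (pbw a b d) = 0.
Proof.
move=> nf f0 d; elim/ltn_ind: d => d IHd a b.
(* The discarded terms have X^+ degree below d, so by induction their coefficients sum to zero word
   by word. *)
pose f' : elF K := [seq t <- f | (d <= count_mem gXp t.1)%N].
have nf' t : t \in f' ->
    (d <= count_mem gXp t.1)%N /\
    t.1 = pbw (count_mem gXm t.1) (count_mem gH t.1) (count_mem gXp t.1).
  rewrite mem_filter => /andP[-> tf]; split => //; apply/eqP.
  by move/allP: nf; apply; apply: map_f.
have ff' : eqvF f f'.
  move=> w; rewrite [RHS]/coefF big_filter_cond.
  case: (leqP d (count_mem gXp w)) => hw.
    apply: eq_bigl => t; rewrite andbC; case: eqP => //= ->; by rewrite hw.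
  rewrite big1 => [|t /andP[+ /eqP tw]]; last by rewrite tw leqNgt hw.
  have [/eqP->|nw] := boolP (is_pbw w); first exact: IHd.
  rewrite /coefF big1_seq // => t /andP[/eqP tw tf].
  by move/allP: nf => /(_ t.1 (map_f _ tf)); rewrite tw (negbTE nw).
pose sel (t : word * K) := (count_mem gXm t.1 == a) && (count_mem gXp t.1 == d).
(* Up to the factor [fallN d n], the value of [p] at n is the coordinate on b_a of f applied to b_d.
   It vanishes at every integer n >= d, hence [p] is zero. *)
pose p : {poly K} := \sum_(t <- f' | sel t) t.2 *: 'X^(count_mem gH t.1).
have pE n : p.[n%:~R] * fallN d n = 0.
  have := f0 n 'X^d; rewrite (evalF_eqv _ ff') => /(congr1 (fun u => u`_a)).
  rewrite coef0 => <-; rewrite /p /evalF coef_sum horner_sum mulr_suml.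
  rewrite big_mkcond big_seq [RHS]big_seq; apply: eq_bigr => t /nf'[ct tE].
  rewrite hornerZ hornerXn coefZ [X in vW n X]tE /sel.
  move: ct; rewrite leq_eqVlt => /orP[/eqP <-|ct].
    rewrite eqxx andbT vW_pbw coefZ coefXn eq_sym.
    by case: eqP => _; rewrite ?mulr1 ?mulr0 // -mulrA [X in _ * X]mulrC.
  by rewrite vW_pbw_gt // (gtn_eqF ct) andbF coef0 mulr0.
have p0 : p = 0.
  apply: (@poly_nat_roots _ d) => m; apply/eqP.
  by have /eqP := pE (d + m)%:Z; rewrite mulf_eq0 (negbTE (fallN_neq0 d m)) orbF.
rewrite ff'; have := congr1 (fun u => u`_b) p0; rewrite coef0 => <-.
rewrite /p /coefF coef_sum big_mkcond [RHS]big_mkcond big_seq [RHS]big_seq.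
apply: eq_bigr => t /nf'[_ tE]; rewrite coefZ coefXn /sel.
have -> : (t.1 == pbw a b d) =
    [&& count_mem gXm t.1 == a, count_mem gXp t.1 == d & b == count_mem gH t.1].
  apply/eqP/and3P => [->|[/eqP<- /eqP<- /eqP->]] //.
  by case: (count_pbw a b d) => -> -> ->.
case: (_ == a) => //=; case: (_ == d) => //=.
by case: eqP => _; rewrite ?mulr1 ?mulr0.
Qed.

(** For the last relation this is (k+1)(n-k) - k(n-k+1) = n - 2k. *)
Lemma kerUhpsi_nat_relsSl2 r : relsSl2 r ->
  kerUhpsi (@natColouring K) (constS r).
Proof.
case=> [?|?|->]; [by apply: kerUhpsi_relsA; left
                 |by apply: kerUhpsi_relsA; right|].
move=> n v p; rewrite actS_constS /evalF; apply/polyP => j; rewrite coef0.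
rewrite !big_cons big_nil /= addr0 !coefD !coefZ /actG /=.
have Xp z k : (actXp (@natColouring K) n z p)`_k =
    (k.+1%:Z * (n - k.+1%:Z + 1))%:~R * (z p)`_k.+1.
  rewrite coef_actXp big_ord_recr /= subnn big1 ?add0r // => i _.
  by rewrite -(subnSK (ltn_ord i)) mul0r.
rewrite Xp coef_actH !coef_actXm; case: j => [|j]; rewrite ?Xp.
  by rewrite double0 !(intrM, intrB, intrD) mulr1z mulr0z; ring.
rewrite doubleS -[j.*2.+2]addn2 -[j.+2]addn2 -[j.+1]addn1 !PoszD -muln2 !PoszM.
rewrite !(intrM, intrB, intrD) !mulr1z. ring.
Qed.

Lemma verma_faithful f :
  (forall n u, evalF (fun w => vW n w u) f = 0) -> genIdealF (@relsSl2 K) f.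
Proof.
move=> f0; have [g ng fg] := spanned_all f.
have [Ieq I0 Iadd Il Ir] := genIdealF_ideal (@relsSl2 K).
apply: (Ieq _ _ _ fg) => w; rewrite coefF_add coefF_opp.
suff -> : coefF g w = 0 by rewrite subr0.
have [/eqP->|nw] := boolP (is_pbw w); last first.
  rewrite /coefF big1_seq // => t /andP[/eqP tw tf].
  by move/allP: ng => /(_ t.1 (map_f _ tf)); rewrite tw (negbTE nw).
apply: pbw_coef_eq0 => // n u.
(* The ideal of sl_2 acts by zero, so the normal form [g] acts as [f] does, by zero. *)
have := fg _ (idealS_constS (kerUhpsi_ideal _)) kerUhpsi_nat_relsSl2.
move=> /(_ n (fun _ => u) 0%N); rewrite actS_constS evalF_add evalF_opp.
have E h : evalF (fun w0 => actW (@natColouring K) n w0 (fun _ => u) 0%N) h =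
    evalF (fun w0 => vW n w0 u) h.
  by apply: eq_bigr => t _; rewrite actW_nat.
by rewrite !E f0 sub0r => /eqP; rewrite oppr_eq0 => /eqP.
Qed.

Lemma kerUsl2h_natColouring x :
  kerUsl2h x <-> kerUhpsi (@natColouring K) x.
Proof.
split; first exact: kerUhpsi_genIdealF kerUhpsi_nat_relsSl2.
move=> kx m; apply: verma_faithful => n u.
(* On a vector concentrated in degree h^0, the coefficient of h^m isolates the action of [x m]. *)
rewrite -[RHS](kx n (fun i => if i is 0 then u else 0) m) actS_evalF.
rewrite big_ord_recr /= subnn big1 ?add0r /= => [|i _].
  by apply: eq_bigr => t _; rewrite actW_nat.
rewrite /evalF big1 // => t _.
by rewrite actW_nat -(subnSK (ltn_ord i)) vW0 scaler0.
Qed.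

End Verma.

(** * Power series over K and identities of q-integers *)

Section PowerSeries.
Variable K : fieldType.
Implicit Types (a b c : serK K).

Definition oneK : serK K := fun m => (m == 0%N)%:R.
Definition subK a b : serK K := fun m => a m - b m.

Lemma mulKC a b : mulK a b = mulK b a.
Proof.
apply: functional_extensionality => m; rewrite /mulK (reindex_inj rev_ord_inj).
apply: eq_bigr => i _ /=; rewrite subSS mulrC subKn //.
by rewrite -ltnS.
Qed.

Lemma mulKA a b c : mulK a (mulK b c) = mulK (mulK a b) c.
Proof.
apply: functional_extensionality => m; rewrite /mulK.
under [RHS]eq_bigr => i _ do rewrite mulr_suml.
rewrite (big_triangle_reindex (fun i j k => a i * b j * c k)).
apply: eq_bigr => i _; rewrite mulr_sumr; apply: eq_bigr => j _.
exact: mulrA.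
Qed.

Lemma mulKACA a b c d :
  mulK (mulK a c) (mulK b d) = mulK (mulK a b) (mulK c d).
Proof. by rewrite -!mulKA [mulK c (mulK b d)]mulKA [mulK c b]mulKC -mulKA. Qed.

Lemma mul1K a : mulK oneK a = a.
Proof.
apply: functional_extensionality => m; rewrite /mulK big_ord_recl mul1r subn0.
by rewrite big1 ?addr0 // => i _; rewrite mul0r.
Qed.

Lemma mulK_subl a b c : mulK (subK a b) c = subK (mulK a c) (mulK b c).
Proof.
apply: functional_extensionality => m; rewrite /mulK /subK -sumrB.
by apply: eq_bigr => i _; rewrite mulrBl.
Qed.

Lemma size_invl c m : size (invl c m) = m.+1.
Proof. by elim: m => //= m IHm; rewrite size_rcons IHm. Qed.

Lemma nth_invl c m i : (i <= m)%N -> nth 0 (invl c m) i = invK c i.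
Proof.
elim: m => [|m IHm]; first by rewrite leqn0 => /eqP ->.
rewrite leq_eqVlt => /orP[/eqP -> //|le_im].
by rewrite /= nth_rcons size_invl le_im IHm.
Qed.

Lemma mulKV c : c 0%N != 0 -> mulK c (invK c) = oneK.
Proof.
move=> c0; apply: functional_extensionality => -[|m].
  by rewrite /mulK big_ord1 /invK /= divff.
rewrite /mulK big_ord_recl /= subn0 [invK c m.+1]/invK /= nth_rcons.
rewrite size_invl ltnn eqxx mulrA mulrN divff // mulN1r addrC.
apply/eqP; rewrite subr_eq0; apply/eqP; apply: eq_bigr => i _.
by rewrite /bump leq0n add1n subSS nth_invl // leq_subr.
Qed.

(** Multiplication by h, which turns [qdiffh] back into a difference of exponentials. *)
Definition shK a : serK K := fun m => if m is m'.+1 then a m' else 0.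

Lemma mulK_shl a b : mulK (shK a) b = shK (mulK a b).
Proof.
apply: functional_extensionality => -[|m]; rewrite /mulK.
  by rewrite big_ord1 mul0r.
by rewrite big_ord_recl mul0r add0r; apply: eq_bigr => i _; rewrite lift0 subSS.
Qed.

Lemma mulK_shr a b : mulK a (shK b) = shK (mulK a b).
Proof. by rewrite mulKC mulK_shl mulKC. Qed.

Definition expK (z : K) : serK K := fun m => z ^+ m / m`!%:R.

Hypothesis char0 : [pchar K] =i pred0.

Lemma fact_char0 m : m`!%:R != 0 :> K.
Proof. by rewrite natr_eq0_char0 // -lt0n fact_gt0. Qed.

(** The binomial theorem, divided by m!. *)
Lemma mulK_exp (y z : K) : mulK (expK y) (expK z) = expK (y + z).
Proof.
apply: functional_extensionality => m; rewrite /expK /mulK addrC exprDn.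
rewrite mulr_suml; apply: eq_bigr => i _.
have le_im : (i <= m)%N by rewrite -ltnS.
have bf : 'C(m, i)%:R * (i`!%:R * (m - i)`!%:R) = m`!%:R :> K.
  by rewrite -!natrM bin_fact.
have := fact_char0 m; rewrite -bf => nz.
have nb : 'C(m, i)%:R != 0 :> K.
  by move: nz; apply: contraNneq => ->; rewrite mul0r.
rewrite -mulr_natr; field.
by rewrite nb !fact_char0.
Qed.

Lemma shK_qdiffh (j : int) :
  shK (qdiffh K j) = subK (expK j%:~R) (expK (- j%:~R)).
Proof.
apply: functional_extensionality => -[|m]; rewrite /subK /expK /=.
  by rewrite subrr.
by rewrite /qdiffh mulrBl.
Qed.

Lemma mulK_qdiffh (i j : int) m :
  mulK (qdiffh K i) (qdiffh K j) m =
  expK (i%:~R + j%:~R) m.+2 - expK (i%:~R - j%:~R) m.+2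
  - expK (- i%:~R + j%:~R) m.+2 + expK (- i%:~R - j%:~R) m.+2.
Proof.
(* Each factor was divided by h once, hence the shift of the index by two. *)
have -> : mulK (qdiffh K i) (qdiffh K j) m =
    mulK (shK (qdiffh K i)) (shK (qdiffh K j)) m.+2.
  by rewrite mulK_shl mulK_shr.
rewrite !shK_qdiffh mulK_subl [mulK _ (subK _ _)]mulKC mulK_subl.
rewrite [X in subK _ X]mulKC mulK_subl /subK.
rewrite [mulK (expK j%:~R) (expK i%:~R)]mulKC.
rewrite [mulK (expK (- j%:~R)) (expK i%:~R)]mulKC.
rewrite [mulK (expK j%:~R) (expK (- i%:~R))]mulKC.
rewrite [mulK (expK (- j%:~R)) (expK (- i%:~R))]mulKC.
rewrite !mulK_exp; ring.
Qed.

(** This is [j+1][n-j] - [j][n-j+1] = [n-2j] with denominators cleared. After expansion the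
    exponentials of n+1 and -n-1 cancel on the left. *)
Lemma qdiffh_identity (j n : int) :
  subK (mulK (qdiffh K (j + 1)) (qdiffh K (n - j)))
       (mulK (qdiffh K j) (qdiffh K (n - j + 1))) =
  mulK (qdiffh K 1) (qdiffh K (n - j *+ 2)).
Proof.
apply: functional_extensionality => m; rewrite /subK !mulK_qdiffh.
rewrite !(mulr2n, intrD, mulrNz, mulr1z).
set x : K := n%:~R; set y : K := j%:~R.
have -> : y + 1 + (x - y) = x + 1 by ring.
have -> : y + 1 - (x - y) = 1 - (x - (y + y)) by ring.
have -> : - (y + 1) + (x - y) = -1 + (x - (y + y)) by ring.
have -> : - (y + 1) - (x - y) = - x - 1 by ring.
have -> : y + (x - y + 1) = x + 1 by ring.
have -> : y - (x - y + 1) = -1 - (x - (y + y)) by ring.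
have -> : - y + (x - y + 1) = 1 + (x - (y + y)) by ring.
have -> : - y - (x - y + 1) = - x - 1 by ring.
ring.
Qed.

Lemma qdiffh1_0 : qdiffh K 1 0%N = 2.
Proof. by rewrite /qdiffh mulr1z !expr1 opprK divr1. Qed.

Lemma two_char0 : 2 != 0 :> K.
Proof. by rewrite (natr_eq0_char0 char0 2). Qed.

Lemma qdiffh1_neq0 : qdiffh K 1 0%N != 0.
Proof. by rewrite qdiffh1_0 two_char0. Qed.

Lemma invK_qdiffh1_0 : invK (qdiffh K 1) 0%N = 2^-1.
Proof. by rewrite /invK /= qdiffh1_0. Qed.

Lemma qColouring_const_term k n : qColouring K k n 0%N = natColouring K k n 0%N.
Proof.
have q0 j : qint K j 0%N = j%:~R.
  rewrite /qint /mulK big_ord1 invK_qdiffh1_0 /qdiffh !expr1 divr1 opprK.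
  rewrite -mulr2n -[_ *+ 2]mulr_natr mulfK //; exact: two_char0.
by rewrite /qColouring /mulK big_ord1 !q0 /natColouring intrM.
Qed.

Lemma qColouring_rec k n :
  subK (qColouring K k.+1 n) (qColouring K k n) =
  mulK (invK (qdiffh K 1)) (qdiffh K (n - (k.*2)%:Z)).
Proof.
rewrite /qColouring /qint.
have -> : n - k.+1%:Z + 1 = n - k%:Z by rewrite -addn1 PoszD; ring.
have -> : k.+1%:Z = k%:Z + 1 by rewrite -addn1 PoszD.
have -> : n - (k.*2)%:Z = n - k%:Z *+ 2 by rewrite -addnn PoszD mulr2n.
rewrite (mulKACA (qdiffh K (k%:Z + 1))) (mulKACA (qdiffh K k)) -mulK_subl.
rewrite qdiffh_identity [mulK (qdiffh K 1) _]mulKC -mulKA.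
(* The factor [qdiffh 1] cancels one of the two inverses. *)
by rewrite [mulK (qdiffh K 1) _]mulKA mulKV ?qdiffh1_neq0 // mul1K mulKC.
Qed.

Lemma qColouring0 n m : qColouring K 0 n m = 0.
Proof.
rewrite /qColouring /qint -mulKA /mulK big1 // => i _.
by rewrite /qdiffh mulr0z oppr0 !expr0n subrr !mul0r.
Qed.

End PowerSeries.

(** * The quantum relation and h-adic approximation *)

Section QuantumKernel.
Variable K : fieldType.
Hypothesis char0 : [pchar K] =i pred0.
Implicit Types (x y : elS K) (f g : elF K).

Lemma coef_actW_H (psi : colourfun K) n k v p j :
  (actW psi n (nseq k gH) v p)`_j = (n - (j.*2)%:Z)%:~R ^+ k * (v p)`_j.
Proof.
elim: k => [|k IHk]; first by rewrite expr0 mul1r.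
by rewrite /= /actG /= coef_actH IHk exprS mulrA.
Qed.

Lemma coef_actS_qH (psi : colourfun K) n v p j :
  (actS psi n (mulS (scalS (invK (qdiffh K 1))) (qHdiffh K)) v p)`_j =
  \sum_(m < p.+1) mulK (invK (qdiffh K 1)) (qdiffh K (n - (j.*2)%:Z)) m
                  * (v (p - m)%N)`_j.
Proof.
rewrite actS_mul /actS coef_sum.
pose F a b c := invK (qdiffh K 1) a * qdiffh K (n - (j.*2)%:Z) b * (v c)`_j.
transitivity (\sum_(i < p.+1) \sum_(l < (p - i).+1) F i l (p - i - l)%N).
  apply: eq_bigr => i _; rewrite big_seq1 coefZ coef_sum mulr_sumr.
  apply: eq_bigr => l _; rewrite big_seq1 coefZ coef_actW_H /F /=.
  by rewrite /qdiffh (exprNn (n - (j.*2)%:Z)%:~R); ring.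
rewrite -big_triangle_reindex; apply: eq_bigr => m _.
by rewrite /mulK mulr_suml.
Qed.

Lemma actS_genS (psi : colourfun K) n e v :
  actS psi n (genS K e) v = actG psi n e v.
Proof.
apply: functional_extensionality => p.
by rewrite [LHS](actS_constS psi n [:: ([:: e], 1)]) /evalF big_seq1 scale1r.
Qed.

Lemma kerUhpsi_relQ : kerUhpsi (@qColouring K) (relQ K).
Proof.
move=> n v p; rewrite /relQ /subS actS_add actS_opp actS_add actS_opp.
rewrite (actS_mul _ _ (genS K gXp)) (actS_mul _ _ (genS K gXm)) !actS_genS.
apply/polyP => j; rewrite !coefB coef0 coef_actS_qH.
have XpXm : (actG (@qColouring K) n gXp (actG (@qColouring K) n gXm v) p)`_j =
    \sum_(m < p.+1) qColouring K j.+1 n m * (v (p - m)%N)`_j.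
  rewrite /actG /= coef_actXp (reindex_inj rev_ord_inj); apply: eq_bigr => i _ /=.
  by rewrite subSS subKn -1?ltnS // coef_actXm.
have XmXp : (actG (@qColouring K) n gXm (actG (@qColouring K) n gXp v) p)`_j =
    \sum_(m < p.+1) qColouring K j n m * (v (p - m)%N)`_j.
  (* At j = 0 the left side vanishes because X^- has no b_0 component in its image, and the right
     side because [0]_q = 0. *)
  rewrite /actG /= coef_actXm; case: {XpXm} j => [|j].
    by rewrite big1 // => m _; rewrite qColouring0 mul0r.
  rewrite /actG /= coef_actXp (reindex_inj rev_ord_inj); apply: eq_bigr => i _ /=.
  by rewrite subSS subKn // -ltnS.
rewrite XpXm XmXp -!sumrB big1 // => m _.
by rewrite -qColouring_rec // /subK; ring.
Qed.

Lemma genClosedIdealS_ideal (G : elS K -> Prop) : idealS (genClosedIdealS G).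
Proof.
split.
- move=> x y xy Ix P Pid Pc PG; case: (Pid) => Peq _ _ _ _.
  exact: Peq xy (Ix _ Pid Pc PG).
- by move=> P [].
- move=> x y Ix Iy P Pid Pc PG; case: (Pid) => _ _ Padd _ _.
  by apply: Padd; [apply: Ix | apply: Iy].
- move=> x y Iy P Pid Pc PG; case: (Pid) => _ _ _ Pl _.
  by apply: Pl; apply: Iy.
- move=> x y Ix P Pid Pc PG; case: (Pid) => _ _ _ _ Pr.
  by apply: Pr; apply: Ix.
Qed.

Lemma genClosedIdealS_hclosed (G : elS K -> Prop) :
  hclosedS (genClosedIdealS G).
Proof.
move=> x Ix P Pid Pc PG; apply: (Pc) => N.
by have [y [Iy xy]] := Ix N; exists y; split=> //; apply: Iy.
Qed.

Lemma kerUhsl2_sub x : kerUhsl2 x -> kerUhpsi (@qColouring K) x.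
Proof.
move=> kx.
apply: (kx (kerUhpsi _)) (kerUhpsi_ideal _) (@kerUhpsi_hclosed _ _) _.
move=> y [Ay|->].
  exact: (kerUhpsi_genIdealF (@kerUhpsi_relsA _ _) Ay).
exact: kerUhpsi_relQ.
Qed.

(** Each coefficient of a product is a nested [evalF], hence depends on either factor only up to
    [eqvF]. *)
Lemma eqvF_mul f f' g g' :
  eqvF f f' -> eqvF g g' -> eqvF (mulF f g) (mulF f' g').
Proof.
move=> ff' gg' w; rewrite !coefF_evalF !evalF_mul.
pose H t1 g : K^o := evalF (fun u => (t1 ++ u == w)%:R : K^o) g.
have E h k : \sum_(t <- h) \sum_(u <- k)
    (t.2 * u.2) *: ((t.1 ++ u.1 == w)%:R : K^o) = evalF (H^~ k) h.
  apply: eq_bigr => t _; rewrite /H /evalF scaler_sumr.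
  by apply: eq_bigr => u _; rewrite scalerA.
rewrite !E (evalF_eqv _ ff'); apply: eq_bigr => t _.
by rewrite /H (evalF_eqv _ gg').
Qed.

Lemma coefS_mul_scalS (c : serK K) y m w :
  coefS (mulS (scalS c) y) m w = \sum_(i < m.+1) c i * coefS y (m - i)%N w.
Proof.
rewrite /coefS /mulS /coefF big_flatten big_map -[m.+1]subn0.
rewrite -/(index_iota 0 m.+1) big_mkord subn0; apply: eq_bigr => i _.
exact: coefF_scale.
Qed.

Lemma relQ_const_term : eqvF (relQ K 0%N) (relSl2 K).
Proof.
move=> w; rewrite /relQ /subS /addS /oppS /mulS /addF /oppF /mulF /=.
rewrite !coefF_cons coefF_nil /= invK_qdiffh1_0 expr1 divr1 opprK.
have -> : 2^-1 * (1 + 1) = 1 :> K by rewrite mulVf // two_char0.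
ring.
Qed.

(** The constant terms of a closed ideal form an ideal of F, and this one contains the three
    relations: modulo h, [relQ] becomes the relation of sl_2. *)
Lemma genIdealF_lift f : genIdealF (@relsSl2 K) f ->
  exists2 y, kerUhsl2 y & eqvF (y 0%N) f.
Proof.
have [Peq P0 Padd Pl Pr] :=
  genClosedIdealS_ideal (fun y => kerUha y \/ y = relQ K).
have mul0 x y : eqvF (mulS x y 0%N) (mulF (x 0%N) (y 0%N)).
  by move=> w; rewrite /mulS /= cats0.
move=> If; apply: (If (fun g => exists2 y, kerUhsl2 y & eqvF (y 0%N) g)).
  split.
  - by move=> g g' gg' [y Py yg]; exists y => // w; rewrite yg.
  - by exists (zeroS K).
  - move=> g g' [y Py yg] [y' Py' yg']; exists (addS y y'); first exact: Padd.
    by move=> w; rewrite !coefF_add yg yg'.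
  - move=> g g' [y Py yg]; exists (mulS (constS g) y); first exact: Pl.
    by move=> w; rewrite mul0; apply: eqvF_mul.
  - move=> g g' [y Py yg]; exists (mulS y (constS g')); first exact: Pr.
    by move=> w; rewrite mul0; apply: eqvF_mul.
have Acase r : relsA r -> exists2 y, kerUhsl2 y & eqvF (y 0%N) r.
  move=> Ar; exists (constS r) => // P _ _; apply; left=> -[|m] Q [] // _ Q0 _ _ _.
  exact.
move=> g [?|?|->]; [by apply: Acase; left | by apply: Acase; right |].
exists (relQ K); last exact: relQ_const_term.
by move=> P _ _; apply; right.
Qed.

(* The constant term of x lies in the ideal of sl_2 and lifts to some y in the
   closed ideal; x - y is then h times an element that again acts by zero. *)
Lemma kerUhpsi_approx N x : kerUhpsi (@qColouring K) x ->
  exists y, kerUhsl2 y /\ forall m w, (m < N)%N -> coefS x m w = coefS y m w.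
Proof.
have [Peq P0 Padd Pl Pr] :=
  genClosedIdealS_ideal (fun y => kerUha y \/ y = relQ K).
elim: N x => [|N IHN] x kx; first by exists (zeroS K).
have /genIdealF_lift[y Py yx] : genIdealF (@relsSl2 K) (x 0%N).
  apply: verma_faithful => // n u.
  rewrite -[RHS](kx n (fun _ => u) 0%N) actS_evalF big_ord1.
  apply: eq_bigr => t _; rewrite actW_const_term // => k.
  exact: qColouring_const_term.
have kxy : kerUhpsi (@qColouring K) (subS x y).
  by move=> n v p; rewrite actS_add actS_opp kx (kerUhsl2_sub Py) subr0.
have xy0 : eqvF (subS x y 0%N) [::].
  by move=> w; rewrite coefF_add coefF_opp yx subrr coefF_nil.
have [z [Pz xyz]] := IHN _ (kerUhpsi_shift kxy xy0).
(* The series h itself, by which the approximation [z] of (x - y)/h is multiplied back. *)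
pose h : serK K := fun m => (m == 1%N)%:R.
exists (addS y (mulS (scalS h) z)); split.
  by apply: Padd => //; apply: Pl.
move=> [|m] w mN; rewrite [RHS]coefF_add -/(coefS _ _ _).
  by rewrite -/(coefS _ _ _) coefS_mul_scalS big_ord1 mul0r addr0; apply/esym/yx.
rewrite -/(coefS (mulS _ _) _ _) coefS_mul_scalS 2!big_ord_recl mul0r add0r mul1r.
rewrite big1 ?addr0 => [|i _]; last by rewrite mul0r.
rewrite subSS subn0 -xyz // /coefS coefF_add coefF_opp; ring.
Qed.

Lemma kerUhsl2_qColouring x : kerUhsl2 x <-> kerUhpsi (@qColouring K) x.
Proof.
split; first exact: kerUhsl2_sub.
by move=> kx; apply: genClosedIdealS_hclosed => N; apply: kerUhpsi_approx.
Qed.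

End QuantumKernel.

(** When the kernels agree, the identity on representatives induces the isomorphism. *)
Lemma isoUhaAlg_eq_ker (K : fieldType) (K1 K2 : elS K -> Prop) :
  idealS K2 -> (forall x, K1 x <-> K2 x) -> isoUhaAlg K1 K2.
Proof.
case=> Keq K0 _ _ _ K12.
have Kxx x : K2 (subS x x).
  apply: Keq K0 => m w; rewrite /coefS coefF_add coefF_opp subrr.
  exact: coefF_nil.
by exists id; do 6?split=> //; move=> y; exists y.
Qed.

Theorem mainTheorem9 (K : fieldType) (char0 : [pchar K] =i pred0) :
  isoUhaAlg (@kerUsl2h K) (kerUhpsi (@natColouring K)) /\
  isoUhaAlg (@kerUhsl2 K) (kerUhpsi (@qColouring K)).
Proof.
by split; apply: isoUhaAlg_eq_ker (kerUhpsi_ideal _) _ => x;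
  [apply: kerUsl2h_natColouring | apply: kerUhsl2_qColouring].
Qed.
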